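(* Let $d\in\{3,7,11,19,43,67,163\}$, let $L=\mathbb{Q}(i\sqrt{d})$ with ring of integers $\mathbb{Z}_L=\mathbb{Z}[\omega]$, $\omega=(1+i\sqrt{d})/2$. Let $m>1$ be a square-free integer with $m\equiv 2,3 \pmod 4$ and $\gcd(d,m)=1$, let $\xi=\sqrt[4]{m}$ and $K=L(\xi)=\mathbb{Q}(i\sqrt{d},\sqrt[4]{m})$. Let $\alpha=H+X\xi+Y\xi^2+Z\xi^3$ with $H,X,Y,Z\in\mathbb{Z}_L$. If $\alpha$ generates a relative power integral basis of $K$ over $L$, i.e. $\mathbb{Z}_K=\mathbb{Z}_L[\alpha]$ (equivalently $\{1,\alpha,\alpha^2,\alpha^3\}$ is a $\mathbb{Z}_L$-basis of $\mathbb{Z}_K$), then there exist $X_0,Y_0\in\mathbb{Z}_L$ and a unit $\zeta$ of $\mathbb{Z}_L$ with \[ X_0^4-mY_0^4=\zeta, \] and a unit $\varepsilon_0$ of $\mathbb{Z}_L$ such that \[ X=X_0^2\varepsilon_0,\qquad Y=\pm X_0Y_0\varepsilon_0,\qquad Z=Y_0^2\varepsilon_0 . \]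
   Context: $\mathbb{Z}_K$ denotes the ring of algebraic integers of $K$. Under the stated hypotheses, $\{1,\xi,\xi^2,\xi^3,\omega,\omega\xi,\omega\xi^2,\omega\xi^3\}$ is an integral basis of $K$, so every $\alpha\in\mathbb{Z}_K$ can be written as $H+X\xi+Y\xi^2+Z\xi^3$ with $H,X,Y,Z\in\mathbb{Z}_L$; $K$ has degree $4$ over $L$, with $\xi$ having relative defining polynomial $x^4-m$ over $L$. *)

(* Defs.v *)
From mathcomp Require Import all_boot all_order all_algebra all_field.
Import Order.TTheory GRing.Theory Num.Theory.
Local Open Scope ring_scope.

Definition squarefree (n : nat) : Prop :=
  forall k : nat, (k ^ 2 %| n)%N -> k = 1%N.

(* Number fields are taken inside algC, as subsets; [Qadj s] is Q(s), the
   smallest subfield of algC containing s. *)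
Definition Qadj (s : seq algC) (x : algC) : Prop :=
  forall F : {pred algC}, divring_closed F -> {subset s <= F} -> x \in F.

Definition ring_of_integers (F : algC -> Prop) (x : algC) : Prop :=
  F x /\ x \in Aint.

(* A[a], as the set of values at a of the polynomials with coefficients in A. *)
Definition ring_adjoin (A : algC -> Prop) (a x : algC) : Prop :=
  exists p : {poly algC}, (forall i : nat, A p`_i) /\ x = p.[a].

Definition unit_of (A : algC -> Prop) (u : algC) : Prop :=
  A u /\ exists v : algC, A v /\ u * v = 1.

Definition isqrt (d : nat) : algC := 'i * sqrtC d%:R.

(* For m >= 0, [4.-root] is the nonnegative real fourth root. *)
Definition xi (m : nat) : algC := 4.-root (m%:R : algC).

Definition L (d : nat) : algC -> Prop := Qadj [:: isqrt d].
Definition K (d m : nat) : algC -> Prop := Qadj [:: isqrt d; xi m].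

Definition ZL (d : nat) : algC -> Prop := ring_of_integers (L d).
Definition ZK (d m : nat) : algC -> Prop := ring_of_integers (K d m).

(* Z_K = Z_L[a], as an equality of subsets of algC. *)
Definition generates_rel_power_integral_basis (d m : nat) (a : algC) : Prop :=
  forall x : algC, ZK d m x <-> ring_adjoin (ZL d) a x.

(* Main.v *)
Require Import Defs.
From mathcomp Require Import all_boot all_order all_algebra all_field.
From mathcomp Require Import zify ring.
Import Order.TTheory GRing.Theory Num.Theory.
Set Implicit Arguments.
Unset Strict Implicit.
Unset Printing Implicit Defensive.
Local Open Scope ring_scope.

(** If Z_K = Z_L[alpha] then xi is a polynomial in alpha over Z_L, and the same
    relation holds for the conjugates of xi, so the divided differences of
    f(t) = H + X t + Y t^2 + Z t^3 at pairs of conjugates are units. Their products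
    show that u = X^2 - m Z^2 and u^2 + 4 m (X Z - Y^2)^2 are units of Z_L; units
    have absolute value 1 and 4 m > 2, hence X Z = Y^2.

    The ideal I = (X, Y) then satisfies I^2 = (X). No class number computation is
    needed, because d is a prime congruent to 3 mod 4 and the class group has no
    2-torsion: if n generates I times its conjugate then X has norm n^2, so by
    Hilbert 90 X = q g^2 with q rational. Taking q squarefree, a prime p <> d
    dividing q would divide both X and Z, hence the unit u; and d is -1 times a
    square in L. So X = +-g^2 with g in Z_L, and Y_0 = Y / g. *)

(** * Closure of [Qadj s] under field operations and conjugation *)

Section QadjClosed.

Variable s : seq algC.

Lemma Qadj1 : Qadj s 1.
Proof. by move=> F [F1 _ _] _. Qed.

Lemma QadjB x y : Qadj s x -> Qadj s y -> Qadj s (x - y).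
Proof. by move=> sx sy F cF sF; have [_ F_B _] := cF; apply: F_B; [apply: sx | apply: sy]. Qed.

Lemma Qadj_div x y : Qadj s x -> Qadj s y -> Qadj s (x / y).
Proof. by move=> sx sy F cF sF; have [_ _ F_d] := cF; apply: F_d; [apply: sx | apply: sy]. Qed.

Lemma Qadj0 : Qadj s 0.
Proof. by rewrite -(subrr 1); apply: QadjB; apply: Qadj1. Qed.

Lemma QadjN x : Qadj s x -> Qadj s (- x).
Proof. by move=> sx; rewrite -sub0r; apply: QadjB => //; apply: Qadj0. Qed.

Lemma QadjD x y : Qadj s x -> Qadj s y -> Qadj s (x + y).
Proof. by move=> sx sy; rewrite -[y]opprK; apply: QadjB => //; apply: QadjN. Qed.

Lemma QadjV x : Qadj s x -> Qadj s x^-1.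
Proof. by move=> sx; rewrite -div1r; apply: Qadj_div => //; apply: Qadj1. Qed.

Lemma QadjM x y : Qadj s x -> Qadj s y -> Qadj s (x * y).
Proof. by move=> sx sy; rewrite -[y]invrK; apply: Qadj_div => //; apply: QadjV. Qed.

Lemma QadjX x n : Qadj s x -> Qadj s (x ^+ n).
Proof.
move=> sx; elim: n => [|n IHn]; first by rewrite expr0; apply: Qadj1.
by rewrite exprS; apply: QadjM.
Qed.

Lemma Qadj_nat n : Qadj s n%:R.
Proof.
elim: n => [|n IHn]; first by rewrite mulr0n; apply: Qadj0.
by rewrite mulrS; apply: QadjD => //; apply: Qadj1.
Qed.

Lemma Qadj_int (n : int) : Qadj s n%:~R.
Proof.
by case: n => n; rewrite ?NegzE ?mulrNz; [|apply: QadjN]; rewrite -pmulrn; apply: Qadj_nat.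
Qed.

(** The preimage of [F] under conjugation is again closed under the field operations and contains
    [s], so the minimality of [Qadj s] applies to it. *)
Lemma Qadj_conj x : {in s, forall y, Qadj s y^*} -> Qadj s x -> Qadj s x^*.
Proof.
move=> sJ sx F cF sF; have [F1 F_B F_d] := cF.
apply: (sx [pred y | y^* \in F]) => [|y sy]; last by apply: sJ.
by split=> [|y z /= Fy Fz|y z /= Fy Fz];
  rewrite inE ?rmorph1 ?rmorphB ?fmorph_div //=; [apply: F_B | apply: F_d].
Qed.

End QadjClosed.

Ltac Qadj_tac := repeat first
  [ assumption | apply: Qadj_nat | apply: Qadj_int | apply: QadjD | apply: QadjN
  | apply: QadjM | apply: QadjX | apply: QadjV | apply: Qadj1 | apply: Qadj0 ].

(** * Criteria for algebraic integrality *)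

Lemma Aint_root_exp n x : (0 < n)%N -> x ^+ n \in Aint -> x \in Aint.
Proof.
move=> n0 xA; have pm := minCpoly_monic (x ^+ n).
apply: (@root_monic_Aint (minCpoly (x ^+ n) \Po 'X^n)).
- by rewrite /root horner_comp hornerXn -/(root _ _) root_minCpoly.
- rewrite monicE lead_coef_comp ?size_polyXn ?ltnS //.
  by rewrite lead_coefXn expr1n mulr1 -monicE.
- by apply: polyOver_comp => //; apply: rpredX; apply: polyOverX.
Qed.

Lemma Aint_trace_norm (x : algC) : x + x^* \in Num.int -> x * x^* \in Num.int -> x \in Aint.
Proof.
move=> tZ nZ.
apply: (@root_monic_Aint ('X^2 - (x + x^*) *: 'X + (x * x^*)%:P)).
- by rewrite /root !hornerE; apply/eqP; ring.
- rewrite -addrA monicE lead_coefDl ?lead_coefXn // size_polyXn ltnS.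
  rewrite (leq_trans (size_polyD _ _)) // geq_max size_polyN.
  rewrite (leq_trans (size_scale_leq _ _)) ?size_polyX //.
  by rewrite (leq_trans (size_polyC_leq1 _)).
- apply/polyOverP=> i; rewrite !coefE.
  apply: rpredD; last by case: ifP => // _; apply: rpred0.
  by apply: rpredB; [apply: rpred_nat | apply: rpredM => //; apply: rpred_nat].
Qed.

Lemma conj_Aint (x : algC) : x \in Aint -> x^* \in Aint.
Proof. by move=> xA; rewrite (Aint_aut Num.conj). Qed.

(** * Rational coordinates on the imaginary quadratic field [L d] *)

Section QuadField.

Variable d : nat.
Hypothesis d_gt0 : (0 < d)%N.

Lemma sqrtd_neq0 : sqrtC (d%:R : algC) != 0.
Proof. by rewrite sqrtC_eq0 pnatr_eq0 -lt0n. Qed.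

Lemma sqrtd_real : sqrtC (d%:R : algC) \is Num.real.
Proof. by rewrite sqrtC_real ?ler0n. Qed.

Lemma isqrt_sqr : isqrt d ^+ 2 = - d%:R.
Proof. by rewrite /isqrt exprMn sqrCi sqrtCK mulN1r. Qed.

Lemma conj_isqrt : (isqrt d)^* = - isqrt d.
Proof. by rewrite rmorphM /= conjCi conj_Creal ?sqrtd_real // mulNr. Qed.

Lemma L_isqrt : L d (isqrt d).
Proof. by move=> F _; apply; rewrite mem_head. Qed.

Lemma L_conj x : L d x -> L d x^*.
Proof.
apply: Qadj_conj => y; rewrite inE => /eqP ->; rewrite conj_isqrt.
by apply: QadjN; apply: L_isqrt.
Qed.

(** The numbers with these two rational coordinates form a field containing [isqrt d], hence
    containing [L d]; inverses are conjugates divided by a rational norm. *)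
Lemma L_coord x : L d x -> ('Re x \in Crat) /\ ('Im x / sqrtC d%:R \in Crat).
Proof.
set s := sqrtC d%:R; have s0 : s != 0 := sqrtd_neq0; have sR : s \is Num.real := sqrtd_real.
have s2 : s ^+ 2 = d%:R by apply: sqrtCK.
have dQ : d%:R \in Crat by apply: rpred_nat.
pose P (x : algC) := ('Re x \in Crat) && ('Im x / s \in Crat).
have ImImE (a b : algC) : 'Im a * 'Im b = d%:R * (('Im a / s) * ('Im b / s)).
  by rewrite -s2; field.
have PM a b : P a -> P b -> P (a * b).
  case/andP=> a1 a2 /andP[b1 b2]; rewrite /P ReM ImM ImImE mulrDl.
  rewrite -!(mulrA _ _ s^-1); apply/andP; split; last by apply: rpredD; apply: rpredM.
  by apply: rpredB; do !apply: rpredM => //.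
have PJ a : P a -> P a^* by rewrite /P Re_conj Im_conj mulNr rpredN.
have PR a : a \in Crat -> P a.
  move=> aQ; have aR := Creal_Crat aQ.
  by rewrite /P (Creal_ReP _ aR) (Creal_ImP _ aR) mul0r aQ rpred0.
have PV a : P a -> P a^-1.
  move=> Pa; rewrite invC_norm; apply: PM; last exact: PJ.
  apply: PR; rewrite rpredV normC2_Re_Im; case/andP: Pa => a1 a2.
  rewrite ['Im a ^+ 2]expr2 ImImE; apply: rpredD; first exact: rpredX.
  by do !apply: rpredM => //.
move=> Lx; apply/andP; apply: (Lx P) => [|y].
  split=> [|a b /andP[? ?] /andP[? ?]|a b aP bP]; first by apply: PR; apply: rpred1.
    by apply/andP; rewrite !raddfB /= mulrBl; split; apply: rpredB.
  by apply: PM => //; apply: PV.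
rewrite inE => /eqP ->; rewrite unfold_in /P /isqrt ReMil ImMil.
by rewrite (Creal_ImP _ sR) (Creal_ReP _ sR) oppr0 divff ?rpred0 ?rpred1.
Qed.

Lemma L_trace_Crat x : L d x -> x + x^* \in Crat.
Proof.
case/L_coord=> xR _; have -> : x + x^* = 'Re x * 2 by rewrite ReE; field.
by rewrite rpredM ?rpred_nat.
Qed.

Lemma L_norm_Crat x : L d x -> x * x^* \in Crat.
Proof.
case/L_coord=> xR xI; rewrite -normCK normC2_Re_Im; apply: rpredD; first exact: rpredX.
have -> : 'Im x ^+ 2 = d%:R * ('Im x / sqrtC d%:R) ^+ 2.
  by rewrite -{1}(sqrtCK d%:R); field; apply: sqrtd_neq0.
by rewrite rpredM ?rpredX ?rpred_nat.
Qed.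

End QuadField.

(** * Divisibility of norms by squares of primes *)

Lemma prime_dvdz_sqr (p : nat) (k : int) : prime p -> (p %| k ^+ 2)%Z -> (p %| k)%Z.
Proof. by move=> pr; rewrite !dvdzE abszX Euclid_dvdX // => /andP[]. Qed.

Lemma prime_dvdz_Ml (p : nat) (k l : int) :
  prime p -> ~~ (p %| k)%Z -> (p %| k * l)%Z -> (p %| l)%Z.
Proof. by move=> pr; rewrite !dvdzE abszM Euclid_dvdM // => /negPf ->. Qed.

Lemma int_parity (k : int) : exists a : int, k = 2 * a \/ k = 2 * a + 1.
Proof. by exists (k %/ 2)%Z; lia. Qed.

Lemma sqr_mod4 (k : int) : exists a : int, k ^+ 2 = 4 * a \/ k ^+ 2 = 4 * a + 1.
Proof.
have [a [->|->]] := int_parity k; first by exists (a ^+ 2); left; ring.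
by exists (a ^+ 2 + a); right; ring.
Qed.

Lemma prime_sqr_dvdz_norm (p d : nat) (n t S : int) :
    prime p -> (d %% 4 = 3)%N -> ~~ (p %| d)%N -> (p %| n)%Z -> (p %| t)%Z ->
  S ^+ 2 = d%:Z * (4 * n - t ^+ 2) -> (p%:Z ^+ 2 %| n)%Z.
Proof.
move=> pr d3 pd /dvdzP[n1 ->] /dvdzP[t1 ->] ES.
have p0 : p%:Z != 0 by rewrite -lt0n prime_gt0.
have /dvdzP[S1 ES1] : (p %| S)%Z.
  apply: prime_dvdz_sqr => //; rewrite ES.
  by apply/dvdzP; exists (d%:Z * (4 * n1 - t1 ^+ 2 * p)); ring.
have E1 : S1 ^+ 2 * p = d%:Z * (4 * n1 - t1 ^+ 2 * p).
  apply: (mulfI p0); transitivity (S ^+ 2); first by rewrite ES1; ring.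
  by rewrite ES; ring.
rewrite expr2; apply: dvdz_mul => //.
have p4n : (p %| 4 * n1)%Z.
  apply: (@prime_dvdz_Ml _ d%:Z) => //; apply/dvdzP.
  by exists (S1 ^+ 2 + d%:Z * t1 ^+ 2); rewrite [RHS]mulrDl [X in _ = X + _]E1; ring.
have [p2|p2] := eqVneq p 2%N; last first.
  apply: (@prime_dvdz_Ml _ 4) => //; rewrite dvdzE /=.
  by rewrite (Euclid_dvdX 2 2 pr) andbT dvdn_prime2.
move: E1 p0; rewrite {}p2 => E1 p0.
have [e de] : exists e : int, d%:Z = 4 * e + 3 
  by exists (d %/ 4)%N%:Z; rewrite {1}(divn_eq d 4) d3 PoszD PoszM mulrC.
have {}E1 : S1 ^+ 2 = 4 * (e * (2 * n1 - t1 ^+ 2)) + 3 * (2 * n1 - t1 ^+ 2).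
  by apply: (mulIf p0); rewrite E1 de; ring.
(* Modulo 4 the equation reads [S1 ^+ 2 = 2 * n1 + t1 ^+ 2]; as squares are 0 or 1, [n1] must be
   even. *)
have [a Ea] := sqr_mod4 S1; have [b Eb] := sqr_mod4 t1.
move: (S1 ^+ 2) (t1 ^+ 2) (e * _) Ea Eb E1 => u v w; clear.
by have [c [->|->]] := int_parity n1; lia.
Qed.

(** * Integers, units and unramified primes of [L d] *)

Section QuadInt.

Variable d : nat.
Hypothesis d_gt0 : (0 < d)%N.

Lemma ZL_trace_int x : ZL d x -> x + x^* \in Num.int.
Proof.
case=> Lx Ax; apply: Cint_rat_Aint; first exact: (L_trace_Crat d_gt0).
by apply: rpredD => //; apply: conj_Aint.
Qed.

Lemma ZL_norm_int x : ZL d x -> x * x^* \in Num.int.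
Proof.
case=> Lx Ax; apply: Cint_rat_Aint; first exact: (L_norm_Crat d_gt0).
by apply: rpredM => //; apply: conj_Aint.
Qed.

Lemma ZL_norm_ge1 x : ZL d x -> x != 0 -> 1 <= `|x| ^+ 2.
Proof.
move=> Zx x0; have := norm_intr_ge1 (ZL_norm_int Zx).
by rewrite mul_conjC_eq0 -normCK normrX normr_id; apply.
Qed.

Lemma ZL_unit_norm x y : ZL d x -> ZL d y -> x * y = 1 -> `|x| = 1.
Proof.
move=> Zx Zy xy1; have x0 : x != 0.
  by apply: contra_eq_neq xy1 => ->; rewrite mul0r eq_sym oner_neq0.
have y0 : y != 0.
  by apply: contra_eq_neq xy1 => ->; rewrite mulr0 eq_sym oner_neq0.
have := ZL_norm_ge1 Zx x0; have := ZL_norm_ge1 Zy y0.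
rewrite !expr_ge1 ?normr_ge0 // => y1 x1; apply/eqP; rewrite eq_le x1 andbT.
by rewrite -(normr1 algC) -xy1 normrM ler_peMr ?normr_ge0.
Qed.

(** Only integrality is asked of [w], because it will be a product of cofactors not known to lie in
    [L d]; being [u^-1], it lies there anyway. *)
Lemma ZL_unit u w : ZL d u -> w \in Aint -> u * w = 1 -> unit_of (ZL d) u /\ `|u| = 1.
Proof.
move=> Zu Aw uw1; have u0 : u != 0.
  by apply: contra_eq_neq uw1 => ->; rewrite mul0r eq_sym oner_neq0.
have Ew : w = u^-1 by apply: (mulfI u0); rewrite uw1 divff.
have Zw : ZL d w by split=> //; rewrite Ew; apply: QadjV; case: Zu.
by split; [split=> //; exists w | apply: (@ZL_unit_norm u w)].
Qed.

Lemma Aint_isqrt : isqrt d \in Aint.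
Proof.
by apply: (@Aint_root_exp 2) => //; rewrite isqrt_sqr rpredN Aint_Cint ?rpred_nat.
Qed.

(** A prime not dividing [d] is unramified in [L d], so it divides [g] as soon as it divides
    [g ^+ 2]. In elementary terms: the trace and norm of [g ^+ 2 / p] show that [p] divides those of
    [g], and then [p ^ 2] divides the norm of [g]. *)
Lemma Aint_div_prime_of_sqr (p : nat) g :
    prime p -> (d %% 4 = 3)%N -> ~~ (p %| d)%N -> ZL d g ->
  g ^+ 2 / p%:R \in Aint -> g / p%:R \in Aint.
Proof.
move=> pr d3 pd Zg Ah; have [Lg Ag] := Zg.
have p0 : p%:R != 0 :> algC by rewrite pnatr_eq0 -lt0n prime_gt0.
have pJ : p%:R^* = p%:R :> algC by rewrite conjC_nat.
have LJ := L_conj Lg; have LI := @L_isqrt d.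
have Zh : ZL d (g ^+ 2 / p%:R) by split=> //; Qadj_tac.
have /intrP[t Et] := ZL_trace_int Zg; have /intrP[n En] := ZL_norm_int Zg.
have /intrP[j Ej] := ZL_trace_int Zh; have /intrP[k Ek] := ZL_norm_int Zh.
(* This number is fixed by conjugation, so it is half its own trace and therefore rational. *)
have /intrP[S ES] : isqrt d * (g - g^*) \in Num.int.
  apply: Cint_rat_Aint.
    have -> : isqrt d * (g - g^*) =
        (isqrt d * (g - g^*) + (isqrt d * (g - g^*))^*) / 2.
      by rewrite rmorphM rmorphB /= conjCK conj_isqrt; field.
    apply: rpredM; last by rewrite rpredV rpred_nat.
    by apply: (L_trace_Crat d_gt0); Qadj_tac.
  by apply: rpredM; [apply: Aint_isqrt | apply: rpredB => //; apply: conj_Aint].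
move: Ej Ek; rewrite fmorph_div rmorphXn /= pJ => Ej Ek.
have Ezj : t ^+ 2 - 2 * n = j * p.
  apply: (@intr_inj algC); rewrite rmorphB rmorphXn !rmorphM /= -Ej -Et -En.
  by field.
have Ezk : n ^+ 2 = k * p * p.
  apply: (@intr_inj algC); rewrite rmorphXn !rmorphM /= -Ek -En.
  by field.
have EzS : S ^+ 2 = d%:Z * (4 * n - t ^+ 2).
  apply: (@intr_inj algC); rewrite rmorphXn rmorphM rmorphB rmorphXn rmorphM /= -ES -Et -En.
  by rewrite exprMn isqrt_sqr; ring.
have pn : (p %| n)%Z by apply: prime_dvdz_sqr => //; rewrite Ezk dvdz_mull.
have pt : (p %| t)%Z.
  apply: prime_dvdz_sqr => //.
  have -> : t ^+ 2 = j * p + 2 * n by rewrite -Ezj; ring.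
  by apply: rpredD; apply: dvdz_mull.
have /dvdzP[n' En'] := prime_sqr_dvdz_norm pr d3 pd pn pt EzS.
have /dvdzP[t' Et'] := pt.
apply: Aint_trace_norm; rewrite fmorph_div /= pJ.
  have -> : g / p%:R + g^* / p%:R = t'%:~R; last exact: intr_int.
  by rewrite -mulrDl Et Et' rmorphM /= mulfK.
have -> : g / p%:R * (g^* / p%:R) = n'%:~R; last exact: intr_int.
by rewrite mulf_div En En' rmorphM rmorphXn /= -expr2 mulfK // expf_neq0.
Qed.

(** The square of [p * r * g] is [p] times the integer [r * x], so [p] divides [p * r * g] and
    [r * g] is integral. Bezout coefficients [a * r + b * p = 1] then give [x / p] as [a] times the
    square of [r * g], plus [b * x]. *)
Lemma Aint_div_prime (p : nat) (r : int) x g :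
    prime p -> (d %% 4 = 3)%N -> ~~ (p %| d)%N -> ~~ (p %| r)%Z -> ZL d x -> L d g ->
  x = p%:R * r%:~R * g ^+ 2 -> x / p%:R \in Aint.
Proof.
move=> pr d3 pd prr [Lx Ax] Lg Ex.
have p0 : p%:R != 0 :> algC by rewrite pnatr_eq0 -lt0n prime_gt0.
have Ah : (p%:R * r%:~R * g) ^+ 2 / p%:R \in Aint.
  have -> : (p%:R * r%:~R * g) ^+ 2 / p%:R = r%:~R * x by rewrite Ex; field.
  by apply: rpredM => //; apply: Aint_int.
have Ag : p%:R * r%:~R * g \in Aint.
  apply: (@Aint_root_exp 2) => //.
  by rewrite -(divfK p0 (_ ^+ 2)) rpredM // Aint_Cint ?rpred_nat.
have Ag' : p%:R * r%:~R * g / p%:R \in Aint.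
  by apply: Aint_div_prime_of_sqr => //; split=> //; Qadj_tac.
have [a [b Eab]] : exists a b : int, a * r + b * p = 1.
  have /coprimezP[[a b] /= Eab] : coprimez r p.
    by rewrite coprimez_sym coprimezE /= prime_coprime.
  by exists a, b.
have -> : x / p%:R = a%:~R * (p%:R * r%:~R * g / p%:R) ^+ 2 + b%:~R * x.
  have -> : x / p%:R = (a * r + b * p)%:~R * x / p%:R by rewrite Eab mul1r.
  by rewrite rmorphD !rmorphM /= Ex; field.
by apply: rpredD; apply: rpredM; rewrite ?Aint_int ?rpredX.
Qed.

End QuadInt.

(** * From [X * Z = Y ^+ 2] to [X] being a square up to sign *)

Section SquareUpToSign.

Variables (d m : nat) (X Y Z : algC).
Hypothesis d_prime : prime d.
Hypothesis d_mod4 : (d %% 4 = 3)%N.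
Hypotheses (ZX : ZL d X) (ZY : ZL d Y) (ZZ : ZL d Z).
Hypothesis XZ_Y2 : X * Z = Y ^+ 2.
Hypothesis u_norm1 : `|X ^+ 2 - m%:R * Z ^+ 2| = 1.
Hypothesis X_neq0 : X != 0.

Let d_gt0 : (0 < d)%N := prime_gt0 d_prime.

(** The witness is the norm of the ideal [(X, Y)], computed as the gcd of the norms of [X] and [Y]
    and the trace of [X * Y^*]. The quotients of its square and the norm of [X], taken both ways,
    are natural numbers with product 1. *)
Lemma norm_eq_sqr : exists2 n : nat, (0 < n)%N & X * X^* = n%:R ^+ 2.
Proof.
have [[LX AX] [LY AY] [LZ AZ]] := And3 ZX ZY ZZ.
have [LXJ LYJ] := (L_conj LX, L_conj LY).
have [AXJ [AYJ AZJ]] := (conj_Aint AX, (conj_Aint AY, conj_Aint AZ)).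
have ZXY : ZL d (X * Y^*) by split; [Qadj_tac | rewrite rpredM].
have /intrP[A EA] := ZL_norm_int d_gt0 ZX.
have /intrP[B EB] := ZL_trace_int d_gt0 ZXY.
have /intrP[C EC] := ZL_norm_int d_gt0 ZY.
have YJ2 : Y^* ^+ 2 = X^* * Z^* by rewrite -rmorphXn -XZ_Y2 rmorphM.
rewrite rmorphM /= conjCK in EB.
have A_gt0 : 0 < (A%:~R : algC) by rewrite -EA mul_conjC_gt0.
pose n : nat := gcdn `|gcdz A B| `|C|; have nE : n%:Z = gcdz (gcdz A B) C by [].
have [a [b [c En]]] : exists a b c : int, n%:Z = a * A + b * B + c * C.
  have [u [v E1]] := Bezoutz A B; have [w [c E2]] := Bezoutz (gcdz A B) C.
  by exists (w * u), (w * v), c; rewrite nE -E2 -E1; ring.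
have /dvdzP[A' EA'] : (n%:Z %| A)%Z := dvdz_trans (dvdz_gcdl _ _) (dvdz_gcdl _ _).
have /dvdzP[B' EB'] : (n%:Z %| B)%Z := dvdz_trans (dvdz_gcdl _ _) (dvdz_gcdr _ _).
have /dvdzP[C' EC'] : (n%:Z %| C)%Z := dvdz_gcdr _ _.
have n_gt0 : (0 < n)%N.
  rewrite lt0n; apply: contraTneq A_gt0 => n0.
  by rewrite EA' n0 mulr0 ltxx.
pose N : algC := n%:R; have N0 : N != 0 by rewrite pnatr_eq0 -lt0n.
have NJ : N^* = N by rewrite conjC_nat.
have EAN : X * X^* = A'%:~R * N by rewrite EA EA' rmorphM.
have EBN : X * Y^* + X^* * Y = B'%:~R * N by rewrite EB EB' rmorphM.
have ECN : Y * Y^* = C'%:~R * N by rewrite EC EC' rmorphM.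
have ENN : N = a%:~R * (X * X^*) + b%:~R * (X * Y^* + X^* * Y) + c%:~R * (Y * Y^*).
  by rewrite EA EB EC -!rmorphM -!rmorphD /= -En.
(* [N] divides the trace of [X * Y^*] by choice, but must divide [X * Y^*] itself: the quotient has
   trace [B'] and norm [A' * C']. *)
have Aw : X * Y^* / N \in Aint.
  apply: Aint_trace_norm; rewrite fmorph_div rmorphM /= conjCK NJ.
    have -> : X * Y^* / N + X^* * Y / N = B'%:~R; last exact: intr_int.
    by rewrite -mulrDl EBN mulfK.
  have -> : X * Y^* / N * (X^* * Y / N) = A'%:~R * C'%:~R.
    transitivity ((X * X^* / N) * (Y * Y^* / N)); first by field.
    by rewrite EAN ECN !mulfK.
  by rewrite rpredM ?intr_int.
have Aw' : X^* * Y / N \in Aint.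
  by have := conj_Aint Aw; rewrite fmorph_div rmorphM /= conjCK NJ.
have P0 : X * X^* != 0 by rewrite mul_conjC_eq0.
have rat_nat q : q \in Crat -> 0 <= q -> q \in Aint -> q \in Num.nat.
  by move=> qQ q0 Aq; rewrite -intrEge0 ?Cint_rat_Aint.
have NQ : N \in Crat by apply: rpred_nat.
have PQ : X * X^* \in Crat by rewrite EA rpred_int.
(* [n^2] lies in the square of [(X, Y)] times its conjugate, and [(X, Y)^2] is
   contained in [(X)] because [Y^2 = X Z]. *)
have Q1 : N ^+ 2 / (X * X^*) \in Num.nat.
  apply: rat_nat; first by rewrite rpredM ?rpredX ?rpredV.
    by rewrite divr_ge0 ?exprn_ge0 ?ler0n ?mul_conjC_ge0.
  have -> : N ^+ 2 / (X * X^*) =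
      a%:~R ^+ 2 * (X * X^*) + 2 * a%:~R * b%:~R * (X * Y^* + X^* * Y)
    + 2 * a%:~R * c%:~R * (Y * Y^*)
    + b%:~R ^+ 2 * (X * Z^* + 2 * (Y * Y^*) + X^* * Z)
    + 2 * b%:~R * c%:~R * (Y * Z^* + Z * Y^*) + c%:~R ^+ 2 * (Z * Z^*).
    apply: (canLR (mulfK P0)); rewrite ENN; move: (X^*) (Y^*) (Z^*) YJ2 => x y z YJ2.
    by ring: XZ_Y2 YJ2.
  by rewrite !(rpredD, rpredM, rpredX, Aint_int, rpred_nat).
(* Conversely [X] lies in [(X, Y)^2] because [X (X^2 - m Z^2) = X^3 - m Z Y^2]. *)
have Q2 : X * X^* / N ^+ 2 \in Num.nat.
  apply: rat_nat; first by rewrite rpredM ?rpredX ?rpredV ?rpredX.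
    by rewrite divr_ge0 ?exprn_ge0 ?ler0n ?mul_conjC_ge0.
  have U1 : (X ^+ 2 - m%:R * Z ^+ 2) * (X^* ^+ 2 - m%:R * Z^* ^+ 2) = 1.
    rewrite -[RHS](expr1n _ 2) -[1 in RHS]u_norm1 normCK.
    by rewrite rmorphB rmorphXn rmorphM rmorphXn /= conjC_nat.
  have -> : X * X^* / N ^+ 2 =
      X * X^* * A'%:~R ^+ 2 - m%:R * X * Z^* * (X * Y^* / N) ^+ 2
    - m%:R * X^* * Z * (X^* * Y / N) ^+ 2 + m%:R ^+ 2 * (Z * Z^*) * C'%:~R ^+ 2.
    have -> : A'%:~R = X * X^* / N by rewrite EAN mulfK.
    have -> : C'%:~R = Y * Y^* / N by rewrite ECN mulfK.
    rewrite -[LHS]mulr1 -[1 in LHS]U1; move: (X^*) (Y^*) (Z^*) YJ2 => x y z YJ2.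
    by rewrite -exprVn; move: (N^-1) => i; ring: XZ_Y2 YJ2.
  by rewrite !(Aw, Aw', AX, AXJ, AZ, AZJ, rpredD, rpredN, rpredX, rpredM, Aint_int, rpred_nat).
have QQ : X * X^* / N ^+ 2 * (N ^+ 2 / (X * X^*)) == 1.
  by rewrite mulrA divfK ?expf_neq0 // divff.
by exists n => //; apply: divr1_eq; apply/eqP; move: QQ; rewrite natr_mul_eq1 // => /andP[].
Qed.

(** With [g = n + X], the relation [X * X^* = n ^ 2] gives [X * g^* = n * g], so [X] is [g ^+ 2]
    times [n] over the norm of [g]. If [g = 0], then [X = - n] already has the required form. *)
Lemma X_eq_rat_sqr : exists q g, [/\ q \in Crat, L d g & X = q * g ^+ 2].
Proof.
have [n n_gt0 EX] := norm_eq_sqr; have [LX _] := ZX.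
have n0 : n%:R != 0 :> algC by rewrite pnatr_eq0 -lt0n.
have [Xn|Xn] := eqVneq (n%:R + X) 0.
  exists (- n%:R), 1; split; [by rewrite rpredN rpred_nat | exact: Qadj1 |].
  by rewrite expr1n mulr1; apply/eqP; rewrite -addr_eq0 addrC Xn.
(* Hilbert 90 for the norm-one element [X / n]. *)
set g := n%:R + X in Xn; have Lg : L d g by rewrite /g; Qadj_tac.
exists (n%:R / (g * g^*)), g; split=> //.
  by apply: rpredM; [apply: rpred_nat | rewrite rpredV (L_norm_Crat d_gt0)].
have gJ0 : g^* != 0 by rewrite conjC_eq0.
have EgJ : g^* = n%:R + X^* by rewrite rmorphD /= conjC_nat.
have -> : n%:R / (g * g^*) * g ^+ 2 = n%:R * g / g^* by field; rewrite Xn gJ0.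
apply: (canRL (mulfK gJ0)); rewrite EgJ /g.
by rewrite !mulrDr EX; ring.
Qed.

(** Strong induction on [r]: a prime factor [p] of [r] is absorbed into [g] if it occurs twice or
    equals [d]; otherwise it would divide both [X] and [Z], against [u_norm1]. *)
Lemma sqr_up_to_sign_strip (r : nat) (b : bool) g :
    (0 < r)%N -> L d g -> X = (-1) ^+ b * r%:R * g ^+ 2 ->
  exists (c : bool) (h : algC), ZL d h /\ X = (-1) ^+ c * h ^+ 2.
Proof.
have [[LX AX] [LY AY] [LZ AZ]] := And3 ZX ZY ZZ.
elim/ltn_ind: r b g => r IHr b g r_gt0 Lg EX.
have [r1|r_neq1] := eqVneq r 1%N.
  exists b, g; rewrite EX r1 mulr1; split=> //; split=> //.
  apply: (@Aint_root_exp 2) => //.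
  have -> : g ^+ 2 = (-1) ^+ b * X by rewrite EX r1 mulr1 signrMK.
  by rewrite rpredM ?rpredX ?rpredN.
have pr : prime (pdiv r) by rewrite pdiv_prime //; case: r r_gt0 r_neq1 {IHr EX} => [|[]].
have /dvdnP[s Er] := pdiv_dvd r; move: (pdiv r) pr Er => p pr Er.
have p1 := prime_gt1 pr; have s_gt0 : (0 < s)%N by move: r_gt0; rewrite Er muln_gt0 => /andP[].
have s_lt : (s < r)%N by rewrite Er -[X in (X < _)%N]muln1 ltn_pmul2l.
have [/dvdnP[k Es]|ps] := boolP (p %| s)%N.
  have k_gt0 : (0 < k)%N by move: s_gt0; rewrite Es muln_gt0 => /andP[].
  apply: (IHr k _ b (p%:R * g)) => //; last 1 first.
  - by rewrite EX Er Es !natrM; ring.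
  - by apply: leq_ltn_trans s_lt; rewrite Es leq_pmulr // ltnW.
  - by Qadj_tac.
have [pd|pd] := boolP (p %| d)%N.
  have Ep : p = d by apply/eqP; rewrite -dvdn_prime2.
  (* As [d = - isqrt d ^+ 2], moving this factor into the square flips the sign. *)
  have LI := @L_isqrt d; apply: (IHr s s_lt (~~ b) (isqrt d * g)) => //; first by Qadj_tac.
  by rewrite signrN exprMn isqrt_sqr EX Er Ep natrM; ring.
have p0 : p%:R != 0 :> algC by rewrite pnatr_eq0 -lt0n prime_gt0.
have s0 : s%:R != 0 :> algC by rewrite pnatr_eq0 -lt0n.
have g0 : g != 0 by apply: contraNneq X_neq0 => g0; rewrite EX g0 expr0n mulr0.
pose t : int := (-1) ^+ b * s%:Z.
have tE : t%:~R = (-1) ^+ b * s%:R :> algC by rewrite rmorphM rmorphXn.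
have pt : ~~ (p %| t)%Z by rewrite dvdzE abszMsign.
have t0 : t%:~R != 0 :> algC by rewrite tE mulf_neq0 ?signr_eq0.
have EXt : X = p%:R * t%:~R * g ^+ 2 by rewrite EX tE Er natrM; ring.
(* By [X * Z = Y ^+ 2], [Z] has the same square class as [X], so divisibility by [p] holds for [Z]
   as well. *)
have EZt : Z = p%:R * t%:~R * (Y / (p%:R * t%:~R * g)) ^+ 2.
  apply: (mulfI X_neq0); rewrite XZ_Y2 {1}EXt; field.
  by rewrite p0 t0 g0.
have AX' : X / p%:R \in Aint by apply: (@Aint_div_prime d d_gt0 p t X g).
have AZ' : Z / p%:R \in Aint.
  by apply: (@Aint_div_prime d d_gt0 p t Z (Y / (p%:R * t%:~R * g))) => //; Qadj_tac.
(* [v] is a nonzero element of [ZL d] of absolute value [p ^ -2], while nonzero integers of [L d]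
   have absolute value at least 1. *)
pose v := (X / p%:R) ^+ 2 - m%:R * (Z / p%:R) ^+ 2.
have Ev : v = (X ^+ 2 - m%:R * Z ^+ 2) / p%:R ^+ 2 by rewrite /v; field.
have Zv : ZL d v.
  split; first by rewrite /v; Qadj_tac.
  apply: rpredB; first exact: rpredX.
  by apply: rpredM; [apply: rpred_nat | apply: rpredX].
have nv : `|v| = (p%:R ^+ 2)^-1 by rewrite Ev normrM u_norm1 mul1r normfV normrX normr_nat.
have v0 : v != 0 by rewrite -normr_eq0 nv invr_eq0 expf_neq0.
have := ZL_norm_ge1 d_gt0 Zv v0.
rewrite expr_ge1 ?normr_ge0 // nv invf_ge1 ?exprn_gt0 ?ltr0n ?prime_gt0 //.
by rewrite -natrX lern1 leqNgt (ltn_exp2l 0).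
Qed.

Lemma sqr_up_to_sign : exists (c : bool) (h : algC), ZL d h /\ X = (-1) ^+ c * h ^+ 2.
Proof.
have [q [g [/CratP[a ->] Lg EX]]] := X_eq_rat_sqr.
have D0 : (denq a)%:~R != 0 :> algC by rewrite intr_eq0 denq_neq0.
have N0 : numq a != 0.
  rewrite numq_eq0; apply: contraNneq X_neq0 => a0.
  by rewrite EX a0 rmorph0 mul0r.
(* A fraction is its numerator times its denominator, over the square of the denominator; that
   square goes into [g]. *)
pose k : int := numq a * denq a.
apply: (@sqr_up_to_sign_strip `|k|%N (k < 0) (g / (denq a)%:~R)).
- by rewrite absz_gt0 mulf_neq0 ?denq_neq0.
- by Qadj_tac.
have -> : (-1) ^+ (k < 0)%R * `|k|%N%:R = k%:~R :> algC.
  by rewrite [k in RHS]intEsign rmorphM rmorphXn.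
by rewrite EX /ratr rmorphM /=; field.
Qed.

End SquareUpToSign.

(** * Divided differences of integral polynomials *)

Lemma horner_Aint (p : {poly algC}) x :
  (forall i, p`_i \in Aint) -> x \in Aint -> p.[x] \in Aint.
Proof. by move=> Ap Ax; apply: rpred_horner => //; apply/polyOverP. Qed.

(** The integral cofactor [w] becomes the inverse of a divided difference of [f] when [p] inverts
    [f] on the conjugates of [xi]. *)
Lemma horner_sub_dvd (p : {poly algC}) x y :
    (forall i, p`_i \in Aint) -> x \in Aint -> y \in Aint ->
  exists2 w, w \in Aint & p.[x] - p.[y] = (x - y) * w.
Proof.
move=> + Ax Ay; elim/poly_ind: p => [|p c IHp] Ap.
  by exists 0; rewrite // !horner0 subrr mulr0.
have {}Ap i : p`_i \in Aint by have := Ap i.+1; rewrite coefD coefMX coefC addr0.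
have [w Aw Ew] := IHp Ap; exists (p.[x] + w * y).
  by apply: rpredD; [apply: horner_Aint | apply: rpredM].
rewrite !hornerE; apply: etrans (_ : p.[x] * (x - y) + (p.[x] - p.[y]) * y = _); first by ring.
by rewrite Ew; ring.
Qed.

(** * Linear independence of the powers of [xi m] over [L d] *)

Section PureQuartic.

Variables d m : nat.
Hypothesis d_gt0 : (0 < d)%N.
Hypothesis m_gt1 : (1 < m)%N.
Hypothesis m_sqfree : squarefree m.

(** A nonzero [b] would make [m] the square of an integer, and the only square-free square is 1. *)
Lemma sqrtm_irrational (a b : algC) :
  a \in Crat -> b \in Crat -> a ^+ 2 = m%:R * b ^+ 2 -> b = 0.
Proof.
move=> Qa Qb E; apply/eqP; apply: contraT => b0.
have E2 : (a / b) ^+ 2 = m%:R by rewrite expr_div_n E mulfK ?expf_neq0.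
have Zab : a / b \in Num.int.
  apply: Cint_rat_Aint; first by rewrite rpredM ?rpredV.
  by apply: (@Aint_root_exp 2) => //; rewrite E2 rpred_nat.
have /natrP[k Ek] := natr_norm_int Zab.
have Em : m = (k ^ 2)%N.
  apply/eqP; rewrite -(eqr_nat algC) -E2 natrX -Ek intr_normK //.
by move: m_gt1; rewrite Em (m_sqfree (k := k)) // Em.
Qed.

Lemma quartic_free_rat (x a b c e : algC) :
    x ^+ 4 = m%:R -> a \in Crat -> b \in Crat -> c \in Crat -> e \in Crat ->
  a + b * x + c * x ^+ 2 + e * x ^+ 3 = 0 -> [/\ a = 0, b = 0, c = 0 & e = 0].
Proof.
move=> x4 Qa Qb Qc Qe E; have Qm : m%:R \in Crat by apply: rpred_nat.
have m0 : m%:R != 0 :> algC by rewrite pnatr_eq0; case: m m_gt1.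
pose R1 := b ^+ 2 + m%:R * e ^+ 2 - 2 * a * c.
pose R2 := a ^+ 2 + m%:R * c ^+ 2 - 2 * m%:R * b * e.
have QR1 : R1 \in Crat by rewrite !(rpredD, rpredN, rpredX, rpredM, rpred_nat).
have QR2 : R2 \in Crat by rewrite !(rpredD, rpredN, rpredX, rpredM, rpred_nat).
(* Separating even and odd powers gives [(a + c x^2)^2 = x^2 (b + e x^2)^2]. *)
have R21 : R2 = R1 * x ^+ 2.
  apply/eqP; rewrite -subr_eq0; apply/eqP.
  transitivity ((a + b * x + c * x ^+ 2 + e * x ^+ 3) *
                (a - b * x + c * x ^+ 2 - e * x ^+ 3)); last by rewrite E mul0r.
  by rewrite /R2 /R1 -x4; ring.
have R1_0 : R1 = 0.
  by apply: (sqrtm_irrational QR2 QR1); rewrite R21 -x4; ring.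
have R2_0 : R2 = 0 by rewrite R21 R1_0 mul0r.
(* The norms from [Q(sqrt m)] of both sides: a square equals [-m] times a square. *)
have EN : (a ^+ 2 - m%:R * c ^+ 2) ^+ 2 + m%:R * (b ^+ 2 - m%:R * e ^+ 2) ^+ 2 = 0.
  transitivity (R2 * (R2 + 4 * m%:R * b * e) + m%:R * R1 * (R1 + 4 * a * c)).
    by rewrite /R1 /R2; ring.
  by rewrite R1_0 R2_0; ring.
have sq_ge0 (y : algC) : y \in Crat -> 0 <= y ^+ 2.
  by move=> Qy; apply: real_exprn_even_ge0 => //; apply: Creal_Crat.
have QN1 : a ^+ 2 - m%:R * c ^+ 2 \in Crat by rewrite !(rpredB, rpredX, rpredM).
have QN2 : b ^+ 2 - m%:R * e ^+ 2 \in Crat by rewrite !(rpredB, rpredX, rpredM).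
have := paddr_eq0 (sq_ge0 _ QN1) (mulr_ge0 (ler0n _ m) (sq_ge0 _ QN2)).
rewrite EN eqxx => /esym/andP[].
rewrite [m%:R * _ == 0]mulf_eq0 (negPf m0) !expf_eq0 /= !subr_eq0 => /eqP N1 /eqP N2.
have c0 := sqrtm_irrational Qa Qc N1; have e0 := sqrtm_irrational Qb Qe N2.
move: N1 N2; rewrite c0 e0 expr0n mulr0 => /eqP; rewrite sqrf_eq0 => /eqP ->.
by move/eqP; rewrite sqrf_eq0 => /eqP ->.
Qed.

Lemma xi4 : xi m ^+ 4 = m%:R.
Proof. exact: rootCK. Qed.

Lemma xi_real : xi m \is Num.real.
Proof. by rewrite ger0_real // rootC_ge0 ?ler0n. Qed.

Lemma xi_neq0 : xi m != 0.
Proof. by rewrite rootC_eq0 // pnatr_eq0; case: m m_gt1. Qed.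

Lemma Aint_quartic_root z : z ^+ 4 = m%:R -> z \in Aint.
Proof. by move=> z4; apply: (@Aint_root_exp 4); rewrite // z4 rpred_nat. Qed.

(** Since [xi m] is real, real and imaginary parts split the relation into two rational ones, after
    dividing the second by the square root of [d]. *)
Lemma xi_free (a b c e : algC) : L d a -> L d b -> L d c -> L d e ->
  a + b * xi m + c * xi m ^+ 2 + e * xi m ^+ 3 = 0 -> [/\ a = 0, b = 0, c = 0 & e = 0].
Proof.
move=> /(L_coord d_gt0)[Ra Ia] /(L_coord d_gt0)[Rb Ib].
move=> /(L_coord d_gt0)[Rc Ic] /(L_coord d_gt0)[Re' Ie] E.
have xR := xi_real; have x2R := rpredX 2 xR; have x3R := rpredX 3 xR.
have s0 := sqrtd_neq0 d_gt0.
have [Ra0 Rb0 Rc0 Re0] :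
    [/\ 'Re a = 0, 'Re b = 0, 'Re c = 0 & 'Re e = 0].
  apply: (quartic_free_rat xi4) => //; move/(congr1 (fun z => 'Re z)): E.
  by rewrite !raddfD /= !ReMr // raddf0.
have [Ia0 Ib0 Ic0 Ie0] : [/\ 'Im a / sqrtC d%:R = 0, 'Im b / sqrtC d%:R = 0,
    'Im c / sqrtC d%:R = 0 & 'Im e / sqrtC d%:R = 0].
  apply: (quartic_free_rat xi4) => //.
  move/(congr1 (fun z => 'Im z / sqrtC d%:R)): E.
  by rewrite !raddfD /= !ImMr // raddf0 mul0r => <-; ring.
have zero (z : algC) : 'Re z = 0 -> 'Im z / sqrtC d%:R = 0 -> z = 0.
  move=> Rz /eqP; rewrite mulf_eq0 invr_eq0 (negPf s0) orbF => /eqP Iz.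
  by rewrite [z]Crect Rz Iz mulr0 addr0.
by split; apply: zero.
Qed.

(** The four coefficients serve every fourth root of [m] at once; this carries a polynomial identity
    at [xi m] over to its conjugates. *)
Lemma horner_quartic (p : {poly algC}) (H X Y Z : algC) :
    (forall i, L d p`_i) -> L d H -> L d X -> L d Y -> L d Z ->
  exists a b c e, [/\ L d a, L d b, L d c & L d e] /\
    forall z, z ^+ 4 = m%:R ->
      p.[H + X * z + Y * z ^+ 2 + Z * z ^+ 3] = a + b * z + c * z ^+ 2 + e * z ^+ 3.
Proof.
move=> + LH LX LY LZ; elim/poly_ind: p => [|p k IHp] Lp.
  have L0 := @Qadj0 [:: isqrt d].
  by exists 0, 0, 0, 0; split=> // z _; rewrite horner0; ring.
have Lk : L d k by have := Lp 0; rewrite coefD coefMX coefC add0r.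
have {}Lp i : L d p`_i by have := Lp i.+1; rewrite coefD coefMX coefC addr0.
have [a [b [c [e [[La Lb Lc Le] IH]]]]] := IHp Lp.
(* One Horner step: multiply by the quartic expression, reduce with [z ^+ 4 = m], and add [k]. *)
exists (a * H + m%:R * (b * Z + c * Y + e * X) + k),
  (a * X + b * H + m%:R * (c * Z + e * Y)), (a * Y + b * X + c * H + m%:R * (e * Z)),
  (a * Z + b * Y + c * X + e * H).
split; first by split; Qadj_tac.
by move=> z z4; rewrite hornerD hornerMX hornerC IH // -z4; ring.
Qed.

(** * Units forced by a relative power integral basis *)

Variables H X Y Z : algC.
Hypotheses (ZH : ZL d H) (ZX : ZL d X) (ZY : ZL d Y) (ZZ : ZL d Z).
Hypothesis gen : generates_rel_power_integral_basis d m
  (H + X * xi m + Y * xi m ^+ 2 + Z * xi m ^+ 3).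

Let f (z : algC) : algC := H + X * z + Y * z ^+ 2 + Z * z ^+ 3.

(** The generator property gives [p] with [p.[f (xi m)] = xi m], and independence over [L d] extends
    this to [p.[f z] = z] for every root. Hence [z - z'] is a multiple of [f z - f z'], which is
    itself [z - z'] times the displayed quotient. *)
Lemma diff_quotient_unit z z' : z ^+ 4 = m%:R -> z' ^+ 4 = m%:R -> z != z' ->
  exists2 w, w \in Aint & (X + Y * (z + z') + Z * (z ^+ 2 + z * z' + z' ^+ 2)) * w = 1.
Proof.
have [[LH AH] [LX AX] [LY AY] [LZ AZ]] := And4 ZH ZX ZY ZZ.
have [p [Zp Ep]] : ring_adjoin (ZL d) (f (xi m)) (xi m).
  apply/gen; split; last exact: Aint_quartic_root xi4.
  by move=> F _; apply; rewrite !inE eqxx orbT.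
have Lp i : L d p`_i by case: (Zp i).
have Ap i : p`_i \in Aint by case: (Zp i).
have [a [b [c [e [[La Lb Lc Le] Epf]]]]] := horner_quartic Lp LH LX LY LZ.
have [a0 b0 c0 e0] : [/\ a = 0, b - 1 = 0, c = 0 & e = 0].
  apply: xi_free => //; first by apply: QadjB => //; apply: Qadj1.
  transitivity (p.[f (xi m)] - xi m); first by rewrite (Epf _ xi4); ring.
  by rewrite -Ep subrr.
have fK y : y ^+ 4 = m%:R -> p.[f y] = y.
  move=> y4; rewrite Epf // a0 c0 e0 -[b](subrK 1) b0; ring.
have Af y : y ^+ 4 = m%:R -> f y \in Aint.
  move=> /Aint_quartic_root Ay.
  by rewrite /f !(AH, AX, AY, AZ, rpredD, rpredM, rpredX).
move=> z4 z'4 zz'; have [w Aw Ew] := horner_sub_dvd Ap (Af _ z4) (Af _ z'4).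
exists w => //; have zz0 : z - z' != 0 by rewrite subr_eq0.
apply: (mulfI zz0); move: Ew; rewrite !fK // mulr1 => {2}->.
by rewrite /f; ring.
Qed.

Lemma index_form_units :
  unit_of (ZL d) (X ^+ 2 - m%:R * Z ^+ 2) /\ `|X ^+ 2 - m%:R * Z ^+ 2| = 1 /\
  X * Z = Y ^+ 2.
Proof.
have [[LX AX] [LY AY] [LZ AZ]] := And3 ZX ZY ZZ.
set u := X ^+ 2 - m%:R * Z ^+ 2; pose v := X * Z - Y ^+ 2.
pose x := xi m; have x4 : x ^+ 4 = m%:R := xi4; have x0 : x != 0 := xi_neq0.
have i2 : 'i ^+ 2 = -1 :> algC := sqrCi _.
have i4 : 'i ^+ 4 = 1 :> algC by rewrite (exprM _ 2 2) i2 sqrrN expr1n.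
have Zu : ZL d u.
  split; first by rewrite /u; Qadj_tac.
  by rewrite !(rpredB, rpredM, rpredX, rpred_nat).
have Zv : ZL d v by split; [rewrite /v; Qadj_tac | rewrite !(rpredB, rpredM, rpredX)].
(* For opposite roots the [Y] term cancels; the pairs through [x] and ['i * x] give conjugate
   factors of [u]. *)
have opp_unit (z : algC) : z ^+ 4 = m%:R -> z != 0 ->
    exists2 w, w \in Aint & (X + Z * z ^+ 2) * w = 1.
  move=> z4 z0; have [||w Aw Ew] := @diff_quotient_unit z (- z) z4.
  - by rewrite -z4; ring.
  - by rewrite -subr_eq0 opprK -mulr2n mulrn_eq0.
  by exists w => //; rewrite -[RHS]Ew; ring.
(* For roots differing by a factor ['i]; the product over all four such pairs is
   [u ^+ 2 + 4 * m%:R * v ^+ 2]. *)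
have rot_unit (z : algC) : z ^+ 4 = m%:R -> z != 0 ->
    exists2 w, w \in Aint & (X + (1 + 'i) * Y * z + 'i * Z * z ^+ 2) * w = 1.
  move=> z4 z0; have [||w Aw Ew] := @diff_quotient_unit z ('i * z) z4.
  - by rewrite exprMn i4 mul1r.
  - apply/eqP => zE; have /negP[] := nonRealCi algC; have -> : 'i = 1 :> algC; last exact: real1.
    by apply: (mulIf z0); rewrite mul1r -zE.
  by exists w => //; rewrite -[RHS]Ew; ring: i2.
have ix4 : ('i * x) ^+ 4 = m%:R by rewrite exprMn i4 mul1r.
have ix0 : 'i * x != 0 by rewrite mulf_neq0 ?neq0Ci.
have Nx4 (z : algC) : z ^+ 4 = m%:R -> (- z) ^+ 4 = m%:R by move=> <-; ring.
have [w1 A1 E1] := opp_unit _ x4 x0; have [w2 A2 E2] := opp_unit _ ix4 ix0.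
have [Uu u1] : unit_of (ZL d) u /\ `|u| = 1.
  apply: (@ZL_unit d d_gt0 u (w1 * w2)) => //; first exact: rpredM.
  transitivity ((X + Z * x ^+ 2) * w1 * ((X + Z * ('i * x) ^+ 2) * w2)).
    by rewrite /u -x4; ring: i2.
  by rewrite E1 E2 mulr1.
split=> //; split=> //.
have [w3 A3 E3] := rot_unit _ x4 x0; have [w4 A4 E4] := rot_unit _ ix4 ix0.
have [||w5 A5 E5] := rot_unit (- x); rewrite ?Nx4 ?oppr_eq0 //.
have [||w6 A6 E6] := rot_unit (- ('i * x)); rewrite ?Nx4 ?oppr_eq0 //.
have [_ n1] : unit_of (ZL d) (u ^+ 2 + 4 * m%:R * v ^+ 2) /\
    `|u ^+ 2 + 4 * m%:R * v ^+ 2| = 1.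
  apply: (@ZL_unit d d_gt0 _ (w3 * w4 * w5 * w6)); last first.
  - have := congr2 *%R (congr2 *%R E3 E5) (congr2 *%R E4 E6).
    by rewrite !mulr1 => E; rewrite -[RHS]E /u /v -x4; ring: i2.
  - by rewrite !rpredM.
  case: Zu Zv => [Lu Au] [Lv Av]; split; first by Qadj_tac.
  by rewrite !(Au, Av, rpredD, rpredX, rpredM, rpred_nat).
(* If [v] were nonzero, [4 * m%:R * v ^+ 2] would have absolute value at least [4 * m], yet it is a
   difference of two numbers of absolute value 1. *)
apply/eqP; rewrite -subr_eq0; apply: contraT => v0.
have v1 := ZL_norm_ge1 d_gt0 Zv v0.
have le2 : `|4 * m%:R * v ^+ 2| <= 2.
  have -> : 4 * m%:R * v ^+ 2 = (u ^+ 2 + 4 * m%:R * v ^+ 2) - u ^+ 2 by ring.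
  by apply: le_trans (ler_normB _ _) _; rewrite n1 normrX u1 expr1n.
have lt2 : 2 < `|4 * m%:R * v ^+ 2|.
  rewrite normrM -natrM normr_nat normrX.
  apply: (@lt_le_trans _ _ ((4 * m)%:R * 1)); last by rewrite ler_pM2l // ltr0n muln_gt0 /= ltnW.
  by rewrite mulr1 ltr_nat (@leq_trans 4) // leq_pmulr // ltnW.
by have := lt_le_trans lt2 le2; rewrite ltxx.
Qed.

End PureQuartic.

(** * Parametrization of [X], [Y], [Z] by [g] and [Y / g] *)

Theorem theorem1 (d m : nat) (H X Y Z : algC)
  (hd : d \in [:: 3; 7; 11; 19; 43; 67; 163]%N)
  (hm1 : (1 < m)%N) (hmsf : squarefree m)
  (hm4 : m = 2 %[mod 4] \/ m = 3 %[mod 4])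
  (hdm : gcdn d m = 1%N)
  (hH : ZL d H) (hX : ZL d X) (hY : ZL d Y) (hZ : ZL d Z)
  (hgen : generates_rel_power_integral_basis d m
            (H + X * xi m + Y * xi m ^+ 2 + Z * xi m ^+ 3)) :
  exists X0 Y0 zeta eps0 : algC,
    [/\ ZL d X0 /\ ZL d Y0,
        unit_of (ZL d) zeta /\ X0 ^+ 4 - m%:R * Y0 ^+ 4 = zeta,
        unit_of (ZL d) eps0
      & [/\ X = X0 ^+ 2 * eps0,
            Y = X0 * Y0 * eps0 \/ Y = - (X0 * Y0 * eps0)
          & Z = Y0 ^+ 2 * eps0]].
Proof.
have [d_prime d_mod4] : prime d /\ (d %% 4 = 3)%N.
  move: hd; rewrite !inE => hd'.
  by do 6?[case/orP: hd' => [/eqP->|hd'] //]; move/eqP: hd' => ->.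
have d_gt0 := prime_gt0 d_prime.
have [Uu [u1 XZ]] := index_form_units d_gt0 hm1 hmsf hH hX hY hZ hgen.
(* If [X] vanished, [m%:R * Z ^+ 2] would have absolute value 1, forcing a nonzero [Z] of norm below
   1. *)
have X_neq0 : X != 0.
  apply/eqP => X0; move: XZ u1; rewrite X0 mul0r expr0n sub0r normrN normrM normr_nat normrX.
  move=> _ u1; have Z0 : Z != 0.
    by apply: contra_eq_neq u1 => ->; rewrite normr0 expr0n mulr0 eq_sym oner_neq0.
  have Z_ge1 := ZL_norm_ge1 d_gt0 hZ Z0; have : `|Z| ^+ 2 < 1.
    by rewrite -[ltRHS]u1 ltr_pMl ?ltr1n // exprn_gt0 // normr_gt0.
  by move/(le_lt_trans Z_ge1); rewrite ltxx.
have [c [g [Zg EX]]] := sqr_up_to_sign d_prime d_mod4 hX hY hZ XZ u1 X_neq0.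
have g0 : g != 0 by apply: contraNneq X_neq0 => g0; rewrite EX g0 expr0n mulr0.
pose e : algC := (-1) ^+ c; have e2 : e ^+ 2 = 1 by rewrite sqrr_sign.
have EZ : Z = (Y / g) ^+ 2 * e.
  apply: (mulfI X_neq0); rewrite XZ EX -/e expr_div_n.
  transitivity (Y ^+ 2 * (e ^+ 2)); first by rewrite e2 mulr1.
  by field.
(* [zeta] is the unit of the index form itself: the sign [e] disappears from it because [X] and [Z]
   enter squared. *)
exists g, (Y / g), (X ^+ 2 - m%:R * Z ^+ 2), e; split.
- split=> //; case: Zg hX hY hZ => [Lg _] _ [LY _] [_ AZ]; split; first by Qadj_tac.
  (* [Y / g] is integral because its square is [Z] up to sign. *)
  apply: (@Aint_root_exp 2) => //.
  have -> : (Y / g) ^+ 2 = Z * e by rewrite EZ -mulrA -expr2 e2 mulr1.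
  by rewrite rpredM // rpredX // rpredN.
- split=> //; rewrite [X in X ^+ 2 - _]EX {1}EZ -/e.
  transitivity (e ^+ 2 * (g ^+ 4 - m%:R * (Y / g) ^+ 4)); first by rewrite e2 mul1r.
  by ring.
- have Ze : ZL d e.
    by split; [rewrite /e; Qadj_tac | rewrite rpredX // rpredN].
  by split=> //; exists e; rewrite -expr2.
- split=> //; first by rewrite mulrC.
  have -> : g * (Y / g) = Y by rewrite mulrC divfK.
  by rewrite /e; case: c {EX e e2 EZ}; rewrite ?mulr1 ?mulrN1 ?opprK; [right | left].
Qed.
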